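(* Let $\Gamma = (I,(A_i)_{i\in I},(u_i)_{i\in I})$ be a game in normal form. Let $\mathcal{E}^n$ and $\mathcal{E}^u$ be the classes of all nested and of all universal elimination sequences of $\Gamma$, and let $\mathbf{\hat{R}}^n$ and $\mathbf{\hat{R}}^u$ be the sets of all maximal reductions of the sequences in $\mathcal{E}^n$ and $\mathcal{E}^u$, respectively. The following statements are equivalent: 1) $\mathbf{\hat{R}}^n = \mathbf{\hat{R}}^u$; 2) every maximal nested reduction $\hat{R}\in \mathbf{\hat{R}}^n$ is completely bounded; 3) $\mathcal{E}^{n} \subseteq \mathcal{E}^{u}$.
   Context: Game. $I$ is a set of players with at least two elements (otherwise of arbitrary cardinality); each $A_i$ is a non-empty set (of arbitrary cardinality) of pure strategies; $A=\prod_{j\in I}A_j$; $u_i:A\to\mathbb{R}$ is player $i$'s payoff function. No topological or measurability assumptions are made. Reductions. A reduction is a subset $R\subseteq A$ of the form $R=\prod_{i\in I}R_i$ with $R_i\subseteq A_i$ (possibly empty). Write $R_{-i}=\prod_{j\neq i}R_j$. Reductions are compared as subsets of $A$. For non-empty $R$ the factors $R_i$ are uniquely determined; all products with an empty factor are the same reduction $\emptyset$, and a relation $R\to\emptyset$ below is understood to hold if it holds for some choice of factors representing $\emptyset$. Strict dominance. For non-empty $R_{-i}$ and $a_i,b_i\in A_i$, write $a_i\prec_{R_{-i}}b_i$ ($a_i$ is strictly dominated by $b_i$ relative to $R_{-i}$) if $u_i(a_i,a_{-i})<u_i(b_i,a_{-i})$ for all $a_{-i}\in R_{-i}$. Dominance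 is defined only relative to non-empty $R_{-i}$; hence conditions about dominance impose nothing when $R=\emptyset$. Let $D_{R_{-i}}(a_i)=\{b_i\in A_i: a_i\prec_{R_{-i}}b_i\}$. For reductions $R,S$: - $R\xrightarrow{n}S$ ($S$ is a nested reduction of $R$) if $S\subseteq R$ and for all $i\in I$: if $a_i\in R_i\setminus S_i$, then there is $b_i\in R_i$ with $a_i\prec_{R_{-i}}b_i$. - $R\xrightarrow{u}S$ ($S$ is a universal reduction of $R$) if $S\subseteq R$ and for all $i\in I$: if $a_i\in R_i\setminus S_i$, then there is $b_i\in A_i$ with $a_i\prec_{R_{-i}}b_i$. Elimination sequences. For $\ell\in\{n,u\}$, an elimination sequence of type $\ell$ (nested if $\ell=n$, universal if $\ell=u$) is an ordinal-indexed sequence of reductions $\langle R^\alpha:\alpha<\delta\rangle$, with $\delta$ any non-zero ordinal, such that: $R^0=A$; $R^\alpha\xrightarrow{\ell}R^{\alpha+1}$ whenever $\alpha+1<\delta$; $R^\lambda=\bigcap_{\alpha<\lambda}R^\alpha$ for all limit ordinals $\lambda<\delta$; and there is a reduction $\hat R$ such that $R^\alpha=\hat R$ for some $\alpha<\delta$ and, for every reduction $S$, $\hat R\xrightarrow{\ell}S$ only if $S=\hat R$. This $\hat R$ is called the maximal reduction of the sequence. A maximal nested (universal) reduction is the maximal reduction of some nested (universal) elimination sequence. Complete boundedness. A reduction $R$ is completely bounded if for all $i\in I$ and all $a_i\in R_i$: if $a_i\prec_{R_{-i}}b_i$ for some $b_i\in A_i$, then there is $c_i^*\in A_i$ such that $a_i\prec_{R_{-i}}c_i^*$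 and there is no $c_i\in A_i$ with $c_i^*\prec_{R_{-i}}c_i$. *)

(* Defs.v *)
(* MathComp-Analysis *)
From mathcomp Require Import all_boot all_order all_algebra.
From mathcomp Require Import boolp classical_sets wochoice reals.

Set Implicit Arguments.
Unset Strict Implicit.
Unset Printing Implicit Defensive.

Import Order.TTheory GRing.Theory Num.Theory.
Local Open Scope classical_set_scope.
Local Open Scope ring_scope.

(* A non-empty well-ordered index type stands for a non-zero ordinal, so a      *)
(* sequence is considered here up to isomorphism of its index.                 *)
Record ordinal_seq (T : Type) := OrdinalSeq {
  index_of : Type;
  index_le : rel index_of;
  index_wo : wochoice.well_order index_le;
  index_inhabited : inhabited index_of;
  term :> index_of -> T }.

Section OrdinalIndex.
Context {T : Type} (s : ordinal_seq T).
Implicit Types a b c : index_of s.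

Definition index_lt a b : Prop := ~~ index_le b a.

Definition is_zero a := forall b, index_le a b.

Definition is_successor a b := index_lt a b /\ forall c, index_lt a c -> index_le b c.

Definition is_limit b := ~ is_zero b /\ forall a, ~ is_successor a b.

End OrdinalIndex.

Section Game.
Context {R : realType} {I : Type} {A : I -> Type}.

Definition profile := forall i, A i.

Definition opponents (i : I) := forall j : {j : I | j <> i}, A (sval j).

Definition combine (i : I) (a : A i) (o : opponents i) : profile := fun j =>
  match pselect (j = i) with
  | left e => ecast k (A k) (esym e) a
  | right ne => o (exist (fun k => k <> i) j ne)
  end.

Definition box (F : forall i, set (A i)) : set profile :=
  [set a | forall i, F i (a i)].

Definition box_but (i : I) (F : forall i, set (A i)) : set (opponents i) :=
  [set o | forall j, F (sval j) (o j)].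
Arguments box_but : clear implicits.

Definition is_reduction (X : set profile) := exists F, X = box F.

Context (u : I -> profile -> R).

(* Meaningful only for non-empty P; it is used below only with P = box_but i F *)
(* under the assumption that box F is non-empty.                               *)
Definition dominated (i : I) (P : set (opponents i)) (a b : A i) : Prop :=
  forall o, P o -> u i (combine a o) < u i (combine b o).

(* The factors of a non-empty product are unique; those of the empty product   *)
(* are not, and some choice of them is required to witness a reduction.        *)
Definition nested_reduction (X Y : set profile) : Prop :=
  Y `<=` X /\
  exists F G, [/\ X = box F, Y = box G &
    X !=set0 -> forall (i : I) (a : A i), F i a -> ~ G i a ->
      exists b : A i, F i b /\ dominated (box_but i F) a b].

Definition universal_reduction (X Y : set profile) : Prop :=
  Y `<=` X /\
  exists F G, [/\ X = box F, Y = box G &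
    X !=set0 -> forall (i : I) (a : A i), F i a -> ~ G i a ->
      exists b : A i, dominated (box_but i F) a b].

Definition completely_bounded (X : set profile) : Prop :=
  exists F, X = box F /\
    (X !=set0 -> forall (i : I) (a : A i), F i a ->
      (exists b : A i, dominated (box_but i F) a b) ->
      exists c' : A i, dominated (box_but i F) a c' /\
        ~ exists c : A i, dominated (box_but i F) c' c).

End Game.
Arguments box_but {I A} i F _.

Section Elimination.
Context {I : Type} {A : I -> Type}.
Variable step : set (@profile I A) -> set (@profile I A) -> Prop.

Definition is_maximal_reduction_of (s : ordinal_seq (set (@profile I A)))
    (X : set (@profile I A)) : Prop :=
  (exists a, s a = X) /\ forall Y, is_reduction Y -> step X Y -> Y = X.

Definition elimination_seq (s : ordinal_seq (set (@profile I A))) : Prop :=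
  [/\ forall a, is_reduction (s a),
      forall a, is_zero a -> s a = setT,
      forall a b, is_successor a b -> step (s a) (s b),
      forall b, is_limit b -> s b = \bigcap_(a in [set a | index_lt a b]) s a
    & exists X, is_maximal_reduction_of s X].

Definition maximal_reductions : set (set (@profile I A)) :=
  [set X | exists s, elimination_seq s /\ is_maximal_reduction_of s X].

End Elimination.

(* Main.v *)
(* The iteration with arbitrary dominators is order independent: a maximal    *)
(* universal reduction survives every universal elimination sequence, so      *)
(* there is at most one. Likewise, if a reduction survives an elimination     *)
(* sequence, a strategy that is undominated in the whole game relative to     *)
(* that reduction is never eliminated by the sequence. Hence, on a completely *)
(* bounded maximal nested reduction, a dominated strategy would have an       *)
(* undominated dominator lying inside the reduction, contradicting nested     *)
(* maximality; so such a reduction is maximal for universal steps as well.    *)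
(* Conversely, a maximal universal reduction is vacuously completely bounded. *)
(* Nested elimination sequences exist by iterating a choice of proper         *)
(* reductions transfinitely: Zermelo's tower, ordered by reverse inclusion,   *)
(* is the required well-order.                                                *)

Require Import Defs.
From mathcomp Require Import all_boot all_order all_algebra.
From mathcomp Require Import boolp classical_sets wochoice reals.

Set Implicit Arguments.
Unset Strict Implicit.
Unset Printing Implicit Defensive.

Local Open Scope classical_set_scope.

(** Everything turns on [survival]: dominance persists when the opponents' strategies shrink, so a
    strategy undominated relative to a non-empty [box F] cannot be removed at a stage containing
    [box F]. Applied to a universally maximal [F] it makes such reductions unique
    ([universal_maximal_unique]); applied to a nested maximal [F] enlarged by all strategies
    undominated relative to it, it gives [completely_bounded_universal_maximal]. Complete
    boundedness thus turns each nested sequence into a universal one with the same maximal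
    reduction, and uniqueness together with [nested_maximal_exists] equates the two sets.
    Conversely, the equality makes nested maximal reductions universally maximal, where boundedness
    is vacuous; so does the inclusion, because a sequence has only one maximal reduction
    ([maximal_reduction_of_unique]). *)

(** * Transfinite induction on well-ordered indices *)

Section OrdinalInduction.
Context {T : Type} (s : ordinal_seq T).
Implicit Types a b c : index_of s.

Lemma index_min (P : index_of s -> Prop) :
  (exists a, P a) -> exists2 a, P a & forall b, P b -> index_le a b.
Proof.
move=> [a Pa].
have [|m [[+ mmin] _]] := @index_wo _ s (fun a => `[<P a>]).
  by exists a; apply/asboolP.
by move=> /asboolP Pm; exists m => // b Pb; apply: mmin; apply/asboolP.
Qed.

Lemma index_total a b : index_le a b \/ index_le b a.
Proof.
have [|m] := @index_min (fun c => c = a \/ c = b); first by exists a; left.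
by move=> [->|->] mP; [left|right]; apply: mP; [right|left].
Qed.

(** Minima in a well-order are unique, and both elements would be least in the pair. *)
Lemma index_anti a b : index_le a b -> index_le b a -> a = b.
Proof.
move=> ab ba; pose P := fun c => `[<c = a \/ c = b>].
have Pa : P a by apply/asboolP; left.
have Pb : P b by apply/asboolP; right.
have [|m [_ muniq]] := @index_wo _ s P; first by exists a.
have aa : index_le a a by have [] := index_total a a.
have bb : index_le b b by have [] := index_total b b.
have am : m = a by apply: muniq; split=> // c /asboolP[] ->.
by rewrite -am; apply: muniq; split=> // c /asboolP[] ->.
Qed.

Lemma index_le_or_lt a b : index_le a b \/ index_lt b a.
Proof. by rewrite /index_lt; case: (index_le a b); [left|right]. Qed.

Lemma index_le_eq_or_lt a b : index_le a b -> a = b \/ index_lt a b.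
Proof.
move=> ab; have [ba|] := index_le_or_lt b a; last by right.
by left; apply: index_anti.
Qed.

Lemma ordinal_ind (P : index_of s -> Prop) :
  (forall b, is_zero b -> P b) ->
  (forall a b, is_successor a b -> P a -> P b) ->
  (forall b, is_limit b -> (forall a, index_lt a b -> P a) -> P b) ->
  forall b, P b.
Proof.
move=> P0 PS Plim b; apply: contrapT => nPb.
have [|{nPb}b nPb bmin] := @index_min (fun a => ~ P a); first by exists b.
have Plt a : index_lt a b -> P a.
  by move=> ab; apply: contrapT => /bmin ba; rewrite /index_lt ba in ab.
have [/P0//|nz] := pselect (is_zero b).
have [[a ab]|nS] := pselect (exists a, is_successor a b).
  by apply: nPb; apply: (PS a) => //; apply: Plt; case: ab.
by apply: nPb; apply: Plim => //; split=> // a ab; apply: nS; exists a.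
Qed.

End OrdinalInduction.

(** * Zermelo's tower of an operator that shrinks sets *)

Section Tower.
Context {T : Type} (f : set T -> set T).
Hypothesis f_sub : forall X, f X `<=` X.

(** The empty family in [tower_cap] supplies the starting point [setT]. *)
Inductive tower : set T -> Prop :=
| tower_next X : tower X -> tower (f X)
| tower_cap (F : set (set T)) :
    (forall X, F X -> tower X) -> tower (\bigcap_(X in F) X).

(* As in Zermelo's theorem: extremality of X yields comparability of X with  *)
(* every member of the tower, and that comparability propagates extremality. *)
Let extreme X := forall Y, tower Y -> X `<=` Y -> X <> Y -> X `<=` f Y.

Let extreme_total X : extreme X ->
  forall Y, tower Y -> X `<=` Y \/ Y `<=` f X.
Proof.
move=> exX Y; elim=> [Z tZ [XZ|ZX]|F tF IH].
- have [->|XneZ] := pselect (X = Z); first by right.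
  by left; apply: exX.
- by right; apply: subset_trans ZX; apply: f_sub.
- have [[Z FZ ZX]|nF] := pselect (exists2 Z, F Z & Z `<=` f X).
    by right=> x /(_ Z FZ)/ZX.
  left=> x Xx Z FZ; case: (IH Z FZ) => [XZ|ZX]; first exact: XZ.
  by case: nF; exists Z.
Qed.

Let tower_extreme X : tower X -> extreme X.
Proof.
elim=> {X} [X tX IH|F tF IH] Y tY sub neq.
- have [XY|YX] := extreme_total IH tY; last by case: neq; apply/seteqP.
  have [->//|XneY] := pselect (X = Y).
  by apply: subset_trans (IH Y tY XY XneY); apply: f_sub.
- have [X FX nYX] : exists2 X, F X & ~ Y `<=` X.
    apply: contrapT => nF; apply: neq; apply/seteqP; split=> // y Yy X FX.
    apply: contrapT => nXy; apply: nF; exists X => // YX.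
    by apply: nXy; apply: YX.
  have capX : \bigcap_(X in F) X `<=` X by move=> x; apply.
  have [XY|YX] := extreme_total (IH X FX) tY; last first.
    by case: nYX; apply: subset_trans YX _; apply: f_sub.
  by apply: subset_trans capX _; apply: IH => // XY'; apply: nYX; rewrite XY'.
Qed.

Lemma tower_total X Y : tower X -> tower Y -> X `<=` Y \/ Y `<=` f X.
Proof. by move=> tX; apply: extreme_total; apply: tower_extreme. Qed.

Lemma tower_strict X Y : tower X -> tower Y ->
  X `<=` Y -> X <> Y -> X `<=` f Y.
Proof. by move=> tX; apply: tower_extreme. Qed.

Lemma tower_fixpoint_least M : tower M -> M `<=` f M ->
  forall Y, tower Y -> M `<=` Y.
Proof.
move=> tM MfM Y; elim=> {Y} [Y tY MY|F tF IH x Mx X FX]; last exact: IH Mx.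
have [<-//|MneY] := pselect (M = Y).
exact: tower_strict.
Qed.

(** Let [M] be the least member of the tower above all of [P]. If [M] were not in [P], then [f M]
    would also bound [P], so [M] would be fixed by [f] and hence least in the tower, below [p0]. *)
Lemma tower_max (P : set (set T)) : P `<=` tower -> P !=set0 ->
  exists2 M, P M & forall X, P X -> X `<=` M.
Proof.
move=> tP [p0 Pp0].
pose U := [set X | tower X /\ forall p, P p -> p `<=` X].
pose M := \bigcap_(X in U) X.
have tM : tower M by apply: tower_cap => X [].
have Mub p : P p -> p `<=` M by move=> Pp x px X [_ Xub]; apply: Xub px.
exists M => //; apply: contrapT => nPM.
have strict p : P p -> ~ M `<=` p.
  move=> Pp Mp; apply: nPM; suff -> : M = p by [].
  by apply/seteqP; split => //; apply: Mub.
have fM_ub p : P p -> p `<=` f M.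
  by move=> Pp; have [/strict|] := tower_total tM (tP p Pp); first by case.
have MfM : M `<=` f M.
  by move=> x /(_ (f M)); apply; split => //; apply: tower_next.
by apply: (strict p0 Pp0); apply: tower_fixpoint_least (tP _ Pp0).
Qed.

(** * The tower as an ordinal sequence *)

Definition stage := {X : set T | tower X}.

Definition stage_le (X Y : stage) : bool := `[<sval Y `<=` sval X>].

Lemma stage_inj (X Y : stage) : sval X = sval Y -> X = Y.
Proof. by case: X Y => [X tX] [Y tY] /= XY; subst Y; congr exist. Qed.

Lemma stage_wo : wochoice.well_order stage_le.
Proof.
apply: antisymmetric_well_order => [X Y|P [X PX]].
  by move=> /andP[/asboolP ? /asboolP ?]; apply: stage_inj; apply/seteqP.
have [||M [tM PM] Mmax] :=
    @tower_max [set Y | exists tY, (exist _ Y tY : stage) \in P].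
- by move=> Y [].
- by case: X PX => X tX PX; exists X, tX.
exists (exist _ M tM : stage); split=> // -[Y tY] PY; apply/asboolP => /=.
by apply: Mmax; exists tY.
Qed.

Lemma tower_setT : tower [set: T].
Proof. by rewrite -(bigcap_set0 id); apply: tower_cap. Qed.

Definition tower_seq : ordinal_seq (set T) :=
  OrdinalSeq stage_wo (inhabits (exist _ _ tower_setT : stage)) sval.
Implicit Types a b : index_of tower_seq.

Lemma tower_seq_surj X : tower X -> exists a, tower_seq a = X.
Proof. by move=> tX; exists (exist _ X tX). Qed.

Lemma tower_seq_tower a : tower (tower_seq a).
Proof. exact: svalP. Qed.

Lemma tower_seq_le a b : index_le a b <-> tower_seq b `<=` tower_seq a.
Proof. by split=> /asboolP. Qed.

Lemma tower_seq_lt a b :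
  index_lt a b <-> tower_seq b `<=` tower_seq a /\ tower_seq a <> tower_seq b.
Proof.
rewrite /index_lt; split=> [/negP|[ba ne]].
  move=> nba; have [ab|ba] := index_total a b; last by case: nba.
  split; first exact/tower_seq_le.
  by move=> e; apply: nba; apply/tower_seq_le; rewrite e.
apply/negP => /tower_seq_le ab; apply: ne; exact/seteqP.
Qed.

Lemma tower_seq_zero a : is_zero a -> tower_seq a = setT.
Proof.
have [t te] := tower_seq_surj tower_setT.
by move=> /(_ t) /tower_seq_le; rewrite te => sub; apply/seteqP; split.
Qed.

Lemma tower_seq_succ a b : is_successor a b ->
  tower_seq b = f (tower_seq a) /\ tower_seq b <> tower_seq a.
Proof.
move=> [/tower_seq_lt[ba ne] ab_min]; split; last exact/nesym.
have ta := tower_seq_tower a; have tb := tower_seq_tower b.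
have nab : ~ tower_seq a `<=` tower_seq b by move=> ab; apply: ne; apply/seteqP.
have bfa : tower_seq b `<=` f (tower_seq a) by have [] := tower_total ta tb.
apply/seteqP; split=> //.
(* The stage [f (tower_seq a)] comes strictly after [a]: otherwise [tower_seq a] would be a fixed
   point, hence contained in [tower_seq b]. *)
have [c ce] := tower_seq_surj (tower_next ta).
rewrite -ce; apply/tower_seq_le/ab_min/tower_seq_lt; rewrite ce; split=> // e.
by apply: nab; apply: tower_fixpoint_least => //; rewrite -e.
Qed.

Lemma tower_seq_limit b : is_limit b ->
  tower_seq b = \bigcap_(a in [set a | index_lt a b]) tower_seq a.
Proof.
move=> [_ nS]; set M := \bigcap_(a in _) _.
have tM : tower M.
  have -> : M =
      \bigcap_(X in [set tower_seq a | a in [set a | index_lt a b]]) X.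
    by rewrite bigcap_image.
  by apply: tower_cap => _ [a _ <-]; apply: tower_seq_tower.
have bM : tower_seq b `<=` M by move=> x bx a /tower_seq_lt[ba _]; apply: ba.
(* The intersection is itself a stage [m]; if it differed from stage [b], then [b] would be the
   successor of [m]. *)
apply: contrapT => ne; have [m me] := tower_seq_surj tM.
apply: (nS m); split.
  by apply/tower_seq_lt; rewrite me; split=> // e; apply: ne.
move=> c /tower_seq_lt[cm ne_mc].
have [//|cb] := index_le_or_lt b c.
case: ne_mc; apply/seteqP; split=> //; rewrite me.
by move=> x; apply.
Qed.

Lemma tower_seq_fixpoint : exists a, f (tower_seq a) = tower_seq a.
Proof.
pose M := \bigcap_(X in tower) X.
have tM : tower M by exact: tower_cap.
have [a ae] := tower_seq_surj tM; exists a; rewrite ae.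
apply/seteqP; split; first exact: f_sub.
by move=> x; apply; apply: tower_next.
Qed.

End Tower.

(** * Products of strategy sets and transfinite runs *)

Section Steps.
Context {I : Type} {A : I -> Type}.
Implicit Types (X Y : set (@profile I A)) (F G K : forall i, set (A i)).

Lemma combineE i (a : A i) (o : @opponents I A i) : combine a o i = a.
Proof.
rewrite /combine; case: pselect => [e|//].
by rewrite (Prop_irrelevance e erefl).
Qed.

Lemma box_combine F i (a : A i) (o : @opponents I A i) :
  F i a -> box_but i F o -> box F (combine a o).
Proof.
move=> Fa Fo j; rewrite /combine; case: pselect => [e|ne]; last first.
  exact: (Fo (exist _ j ne)).
by case: _ / (esym e).
Qed.

Lemma box_subP F G : box F !=set0 ->
  box F `<=` box G -> forall i, F i `<=` G i.
Proof.
move=> [x Fx] FG i a Fa; pose o : @opponents I A i := fun j => x (sval j).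
have : box F (combine a o) by apply: box_combine => // j; apply: Fx.
by move=> /FG /(_ i); rewrite combineE.
Qed.

Lemma box_inj F G : box F !=set0 -> box F = box G -> F = G.
Proof.
move=> ne FG; apply/functional_extensionality_dep => i; apply/seteqP; split.
  by apply: box_subP => //; rewrite FG.
by apply: box_subP => //; [rewrite -FG | rewrite FG].
Qed.

Lemma bigcap_reduction (P : set (set (@profile I A))) :
  (forall X, P X -> is_reduction X) -> is_reduction (\bigcap_(X in P) X).
Proof.
(* Quantifying over all representations of each member avoids choosing factors for it. *)
move=> Pred; exists (fun i => [set a | forall X F, P X -> X = box F -> F i a]).
apply/seteqP; split=> [x Px i X F PX XF|x xF X PX].
  by have := Px X PX; rewrite XF; apply.
by have [F XF] := Pred X PX; rewrite XF => i; apply: xF PX XF.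
Qed.

Definition remove F i (a : A i) : forall j, set (A j) :=
  fun j => [set c | F j c /\ forall e : i = j, c <> ecast k (A k) e a].

Lemma remove_neq F i (a : A i) : box F !=set0 -> F i a ->
  box (remove F a) <> box F.
Proof.
move=> ne Fa e; have := box_subP ne.
move=> /(_ (remove F a)); rewrite e.
by move=> /(_ (@subset_refl _ _) i a Fa)[_ /(_ erefl)].
Qed.

(** Only [a] is removed, so a property of all eliminated strategies has to be checked at [a]
    alone. *)
Lemma remove_elim F i (a : A i) (P : forall j, A j -> Prop) :
  P i a -> forall j c, F j c -> ~ remove F a c -> P j c.
Proof.
move=> Pa j c Fc nrem.
have [e ->] : exists e : i = j, c = ecast k (A k) e a.
  apply: contrapT => ne; apply: nrem; split=> // e ce; apply: ne; by exists e.
by case: _ / e.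
Qed.

(** This omits the existence of a maximal reduction, so that a nested sequence can be treated as a
    universal run before it is known to end in a universally maximal reduction. *)
Definition runs (step : set (@profile I A) -> set (@profile I A) -> Prop)
    (s : ordinal_seq (set (@profile I A))) : Prop :=
  [/\ forall a, is_zero a -> s a = setT,
      forall a b, is_successor a b -> step (s a) (s b) &
      forall b, is_limit b -> s b = \bigcap_(a in [set a | index_lt a b]) s a].

Section Runs.
Variable step : set (@profile I A) -> set (@profile I A) -> Prop.
Hypothesis step_sub : forall X Y, step X Y -> Y `<=` X.
Variable s : ordinal_seq (set (@profile I A)).
Hypothesis run : runs step s.

Lemma runs_antitone a b : index_le a b -> s b `<=` s a.
Proof.
have [s0 sS slim] := run.
elim/(@ordinal_ind _ s): b a => [b bz|a' b a'b IH|b lb IH] a ab.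
- by rewrite (index_anti ab (bz a)).
- have [->//|alt] := index_le_eq_or_lt ab.
  apply: subset_trans (step_sub (sS _ _ a'b)) (IH _ _).
  have [//|/a'b.2 ba] := index_le_or_lt a a'.
  by rewrite /index_lt ba in alt.
- have [->//|alt] := index_le_eq_or_lt ab.
  by rewrite (slim b lb) => x; apply.
Qed.

Lemma maximal_sub_run X : (forall a, is_reduction (s a)) ->
  is_maximal_reduction_of step s X -> forall b, X `<=` s b.
Proof.
move=> sred [[a <-] amax]; have [s0 sS slim] := run.
elim/(@ordinal_ind _ s) => [b bz|c b cb IH|b lb IH].
- by rewrite (s0 b bz).
- have [ac|ca] := index_le_or_lt a c; last exact/runs_antitone/cb.2.
  (* From index [a] on the run is constant: maximality makes the step out of [s c] trivial. *)
  have ac_eq : s a = s c by apply/seteqP; split => //; apply: runs_antitone.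
  by rewrite (amax (s b)) // ac_eq; apply: sS.
- by rewrite (slim b lb) => x ax c cb; apply: IH ax.
Qed.

End Runs.

Lemma elimination_runs step (s : ordinal_seq (set (@profile I A))) :
  elimination_seq step s -> runs step s.
Proof. by case. Qed.

Lemma maximal_reduction_of_unique step (s : ordinal_seq (set (@profile I A)))
    X Y :
  (forall X Y, step X Y -> Y `<=` X) -> elimination_seq step s ->
  is_maximal_reduction_of step s X -> is_maximal_reduction_of step s Y -> X = Y.
Proof.
move=> step_sub sE sX sY; have run := elimination_runs sE.
have sred a : is_reduction (s a) by case: sE.
have XS := maximal_sub_run step_sub run sred sX.
have YS := maximal_sub_run step_sub run sred sY.
case: sX sY => [[a ea] _] [[b eb] _].
by apply/seteqP; split; [rewrite -eb | rewrite -ea].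
Qed.

Lemma elimination_seq_exists step :
  (forall X Y, step X Y -> Y `<=` X) -> exists s X,
  elimination_seq step s /\ is_maximal_reduction_of step s X.
Proof.
move=> step_sub.
(* [f] picks a proper reduction whenever there is one and is the identity otherwise; a fixed point
   is therefore maximal. *)
have /choice[f fP] : forall X, exists Y, [/\ is_reduction X -> is_reduction Y,
    Y `<=` X, Y <> X -> step X Y &
    Y = X -> forall Z, is_reduction Z -> step X Z -> Z = X].
  move=> X.
  have [[Y [Yred XY YX]]|nY] :=
    pselect (exists Y, [/\ is_reduction Y, step X Y & Y <> X]).
    by exists Y; split=> //; apply: step_sub.
  exists X; split=> // _ Y Yred XY.
  by apply: contrapT => YX; apply: nY; exists Y.
have f_sub X : f X `<=` X by case: (fP X).
have tred X : tower f X -> is_reduction X.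
  elim=> {X} [X _ Xred|P _ Pred]; first by case: (fP X) => + _ _ _; apply.
  exact: bigcap_reduction.
pose s := tower_seq f_sub; have [m fm] := tower_seq_fixpoint f_sub.
have smax : is_maximal_reduction_of step s (s m).
  by split; [exists m | case: (fP (s m)) => _ _ _; apply].
exists s, (s m); split=> //; split=> //.
- by move=> a; apply/tred/tower_seq_tower.
- by move=> a /tower_seq_zero.
- move=> a b /tower_seq_succ[e ne]; rewrite -/s in e ne.
  by rewrite e; case: (fP (s a)) => _ _ + _; apply; rewrite -e.
- by move=> b /tower_seq_limit.
- by exists (s m).
Qed.

End Steps.

(** * Dominance, maximality and survival *)

Section Game.
Context {R : realType} {I : Type} {A : I -> Type}.
Variable u : I -> @profile I A -> R.
Implicit Types (X Y : set (@profile I A)) (F G K : forall i, set (A i)).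

Lemma nested_sub X Y : nested_reduction u X Y -> Y `<=` X.
Proof. by case. Qed.

Lemma nested_universal X Y :
  nested_reduction u X Y -> universal_reduction u X Y.
Proof.
move=> [YX [F [G [eX eY H]]]]; split=> //; exists F, G.
split=> // ne i a Fa nGa.
by have [b [_ ab]] := H ne i a Fa nGa; exists b.
Qed.

Lemma box_but_sub F G i : (forall j, F j `<=` G j) ->
  box_but i F `<=` box_but i G.
Proof. by move=> FG o Fo j; apply: FG. Qed.

Lemma dominated_sub i (P Q : set (@opponents I A i)) (a b : A i) :
  P `<=` Q -> dominated u Q a b -> dominated u P a b.
Proof. by move=> PQ ab o /PQ /ab. Qed.

Definition undominated F := forall i (a : A i), F i a ->
  ~ exists b, dominated u (box_but i F) a b.

(** Otherwise deleting [a] alone would be a proper nested reduction. *)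
Lemma nested_maximal_undominated F : box F !=set0 ->
  (forall Y, is_reduction Y -> nested_reduction u (box F) Y -> Y = box F) ->
  forall i (a b : A i), F i a -> F i b -> ~ dominated u (box_but i F) a b.
Proof.
move=> ne Fmax i a b Fa Fb ab; apply: (remove_neq ne Fa); apply: Fmax.
  by eexists.
split; first by move=> x Fx j; case: (Fx j).
exists F, (remove F a); split=> // _.
apply: (@remove_elim _ _ F i a
  (fun j c => exists d, F j d /\ dominated u (box_but j F) c d)).
by exists b.
Qed.

Lemma universal_maximal_undominated F : box F !=set0 ->
  (forall Y, is_reduction Y -> universal_reduction u (box F) Y -> Y = box F) ->
  undominated F.
Proof.
move=> ne Fmax i a Fa [b ab]; apply: (remove_neq ne Fa); apply: Fmax.
  by eexists.
split; first by move=> x Fx j; case: (Fx j).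
exists F, (remove F a); split=> // _.
apply: (@remove_elim _ _ F i a
  (fun j c => exists d, dominated u (box_but j F) c d)).
by exists b.
Qed.

Lemma undominated_universal_maximal F Y :
  (box F !=set0 -> undominated F) ->
  universal_reduction u (box F) Y -> Y = box F.
Proof.
move=> Fund [YF [F' [G' [eF eY H]]]]; apply/seteqP; split=> // x Fx.
have ne : box F !=set0 by exists x.
have eFF := box_inj ne eF; subst F'; rewrite eY => i; apply: contrapT => nG.
exact: (Fund ne i (x i)) (H ne i (x i) (Fx i) nG).
Qed.

Lemma universal_maximal_completely_bounded X : is_reduction X ->
  (forall Y, is_reduction Y -> universal_reduction u X Y -> Y = X) ->
  completely_bounded u X.
Proof.
move=> [F ->] Xmax; exists F; split=> // ne i a Fa ab.
by case: (universal_maximal_undominated ne Xmax Fa).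
Qed.

Section Survival.
Variable s : ordinal_seq (set (@profile I A)).
Hypothesis run : runs (universal_reduction u) s.

(** At a successor step, a strategy of [K] that is lost is dominated relative to factors containing
    [F], hence relative to [F]; but dominated strategies of [K] are assumed to occur at every
    stage. *)
Lemma survival F K : box F !=set0 -> (forall i, F i `<=` K i) ->
  (forall i (a : A i), K i a -> (exists b, dominated u (box_but i F) a b) ->
     forall t, exists2 x, s t x & x i = a) ->
  forall t, box K `<=` s t.
Proof.
move=> [x0 Fx0] FK Kdom; have [s0 sS slim] := run.
elim/(@ordinal_ind _ s) => [t /s0 -> //|c t ct IH|t lt IH].
- have [_ [F' [G' [ec et H]]]] := sS c t ct.
  have neK : box K !=set0 by exists x0 => i; apply: FK.
  have nec : s c !=set0 by case: neK => x /IH; exists x.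
  move=> x Kx; rewrite et => i; apply: contrapT => nG.
  have KF' : forall j, K j `<=` F' j by apply: box_subP => //; rewrite -ec.
  have [b xb] := H nec i (x i) (KF' i _ (Kx i)) nG.
  have dom : dominated u (box_but i F) (x i) b.
    apply: dominated_sub xb; apply: box_but_sub => j.
    exact: subset_trans (FK j) (KF' j).
  have [y + yx] := Kdom i (x i) (Kx i) (ex_intro _ b dom) t.
  by rewrite et => /(_ i); rewrite yx.
- by rewrite (slim t lt) => x Kx c ct; apply: IH.
Qed.

Lemma universal_maximal_survival X : is_reduction X ->
  (forall Y, is_reduction Y -> universal_reduction u X Y -> Y = X) ->
  forall t, X `<=` s t.
Proof.
move=> [F ->] Xmax t x Fx; have ne : box F !=set0 by exists x.
apply: (survival ne (fun i => @subset_refl _ (F i))) => // i a Fa ab.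
by case: (universal_maximal_undominated ne Xmax Fa).
Qed.

End Survival.

Lemma universal_maximal_unique X Y :
  maximal_reductions (universal_reduction u) X ->
  maximal_reductions (universal_reduction u) Y -> X = Y.
Proof.
move=> [s [sE [[a <-] amax]]] [t [tE [[b <-] bmax]]].
have sred : forall c, is_reduction (s c) by case: sE.
have tred : forall c, is_reduction (t c) by case: tE.
apply/seteqP; split.
  exact: (universal_maximal_survival (elimination_runs tE)).
exact: (universal_maximal_survival (elimination_runs sE)).
Qed.

Lemma completely_bounded_universal_maximal s X :
  elimination_seq (nested_reduction u) s ->
  is_maximal_reduction_of (nested_reduction u) s X -> completely_bounded u X ->
  forall Y, is_reduction Y -> universal_reduction u X Y -> Y = X.
Proof.
move=> sE sX [F [eX cb]] Y _; subst X.
have run := elimination_runs sE.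
have urun : runs (universal_reduction u) s.
  by case: run => s0 sS slim; split=> // a b /sS /nested_universal.
have sred : forall c, is_reduction (s c) by case: sE.
have Fs := maximal_sub_run nested_sub run sred sX.
have [[t et] Fmax] := sX.
apply: undominated_universal_maximal => ne i a Fa ab.
have [c [ac nc]] := cb ne i a Fa ab.
apply: (@nested_maximal_undominated F ne Fmax i a c) => //.
(* The undominated dominator [c] lies in [K], whose dominated strategies all lie in [F] and so occur
   at every stage. Survival up to stage [t] then puts [c] in [F], against nested maximality. *)
pose K j := [set d : A j | F j d \/ ~ exists e, dominated u (box_but j F) d e].
have FK j : F j `<=` K j by move=> d; left.
have Ks : box K `<=` box F.
  rewrite -et; apply: (survival urun ne FK) => j d [Fd|//] _ t'.
  have [x Fx] := ne; pose o : @opponents I A j := fun k => x (sval k).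
  exists (combine d o); last exact: combineE.
  by apply: Fs; apply: box_combine => // k; apply: Fx.
apply: (box_subP _ Ks); last by right.
by case: ne => x Fx; exists x => j; apply: FK.
Qed.

Lemma nested_maximal_exists :
  exists X, maximal_reductions (nested_reduction u) X.
Proof.
have [s [X sX]] := elimination_seq_exists nested_sub.
by exists X, s.
Qed.

End Game.

Theorem theorem1 (R : realType) (I : Type) (A : I -> Type)
    (u : I -> (forall i, A i) -> R)
    (two_players : exists i j : I, i <> j)
    (strategies_inhabited : forall i, inhabited (A i)) :
  ((maximal_reductions (nested_reduction u) =
      maximal_reductions (universal_reduction u)) <->
   (forall X : set (forall i, A i),
      maximal_reductions (nested_reduction u) X -> completely_bounded u X))
  /\
  ((forall X : set (forall i, A i),
      maximal_reductions (nested_reduction u) X -> completely_bounded u X) <->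
   (forall s : ordinal_seq (set (forall i, A i)),
      elimination_seq (nested_reduction u) s ->
      elimination_seq (universal_reduction u) s)).
Proof.
have cb_sub : (forall X, maximal_reductions (nested_reduction u) X ->
    completely_bounded u X) -> forall s X,
    elimination_seq (nested_reduction u) s ->
    is_maximal_reduction_of (nested_reduction u) s X ->
    elimination_seq (universal_reduction u) s /\
    is_maximal_reduction_of (universal_reduction u) s X.
  move=> cb s X sE sX; have cbX : completely_bounded u X by apply: cb; exists s.
  have Xmax : is_maximal_reduction_of (universal_reduction u) s X.
    split; first by case: sX.
    exact: completely_bounded_universal_maximal sE sX cbX.
  case: sE => sred s0 sS slim _; split=> //; split=> //; last by exists X.
  by move=> a b /sS /nested_universal.
have umax_cb X : maximal_reductions (universal_reduction u) X ->
    completely_bounded u X.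
  move=> [s [[sred _ _ _ _] [[a <-] amax]]].
  exact: universal_maximal_completely_bounded.
split; split.
- by move=> -> X /umax_cb.
- move=> cb; have nu X : maximal_reductions (nested_reduction u) X ->
      maximal_reductions (universal_reduction u) X.
    by move=> [s [sE sX]]; exists s; apply: cb_sub.
  apply/seteqP; split=> [X|Y uY]; first exact: nu.
  (* Some nested maximal reduction exists and is universally maximal, so by uniqueness it is [Y]. *)
  have [X nX] := nested_maximal_exists u.
  by rewrite (universal_maximal_unique uY (nu X nX)).
- move=> cb s sE; have [_ _ _ _ [X sX]] := sE.
  exact: (cb_sub cb s X sE sX).1.
- move=> nu X [s [sE sX]]; apply: umax_cb; exists s.
  have sEu := nu s sE; split=> //.
  have [sred _ _ _ [Y sY]] := sEu.
  (* Nested steps are universal steps, so [Y] is also nested maximal in [s] and must equal [X]. *)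
  have sYn : is_maximal_reduction_of (nested_reduction u) s Y.
    by case: sY => ? Ymax; split=> // Z Zred /nested_universal; apply: Ymax.
  by rewrite (maximal_reduction_of_unique (@nested_sub _ _ _ u) sE sX sYn).
Qed.
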